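(* For all integers $2\le j\le n$ and all $k$, $$B_{n,k}^{(j)}(q)=\sum_{\substack{\pi\in\mathfrak{S}_n^{(j)}\\ \mathrm{des}(\pi)=k}}q^{\mathrm{ai}(\pi)+2j-n-1},$$ where $B_{n,k}^{(j)}(q)$ denotes the restricted $q$-Eulerian numbers.
   Context: Notation: $(q;q)_n=\prod_{i=1}^n(1-q^i)$, $(q;q)_0=1$; $e(z;q)=\sum_{n\ge 0}\frac{z^n}{(q;q)_n}$. All generating functions are formal power series in $z$. The $(q,r)$-Eulerian polynomials $A_n(t,r,q)$, $n\ge 0$, are defined by $$\sum_{n\ge 0}A_n(t,r,q)\frac{z^n}{(q;q)_n}=\frac{(1-t)e(rz;q)}{e(tz;q)-te(z;q)},$$ and $A_n(t,q):=A_n(t,1,q)$. For $1\le j\le n$ the restricted $q$-Eulerian polynomials $B_n^{(j)}(t,q)$ are defined by $$\sum_{n\ge j}B_n^{(j)}(t,q)\frac{z^{n-1}}{(q;q)_{n-1}}=\left(\frac{A_{j-1}(t,q)(qz)^{j-1}}{(q;q)_{j-1}}\right)\frac{e(tz;q)-te(tz;q)}{e(tz;q)-te(z;q)},$$ and the restricted $q$-Eulerian numbers by $B_n^{(j)}(t,q)=\sum_k B_{n,k}^{(j)}(q)t^k$. $\mathfrak{S}_n$ is the set of permutations of $[n]=\{1,\dots,n\}$, and $\mathfrak{S}_n^{(j)}=\{\pi\in\mathfrak{S}_n:\pi(j)=n\}$. $\mathrm{des}(\pi)$ is the number of $i$ with $1\le i\le n-1$ and $\pi(i)>\pi(i+1)$.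 An inversion of $\pi$ is a pair $(\pi(i),\pi(j))$ with $1\le i<j\le n$ and $\pi(i)>\pi(j)$; it is admissible if either (1) $1<i$ and $\pi(i-1)<\pi(i)$, or (2) there is some $l$ with $i<l<j$ and $\pi(i)<\pi(l)$. $\mathrm{ai}(\pi)$ is the number of admissible inversions of $\pi$. *)

(* Defs.v *)
From HB Require Import structures.
From mathcomp Require Import all_boot all_order all_algebra all_fingroup.

Set Implicit Arguments.
Unset Strict Implicit.
Unset Printing Implicit Defensive.

Import GRing.Theory.
Local Open Scope ring_scope.

Section PowerSeries.
Variable F : fieldType.

(* A formal power series in z over F is its sequence of coefficients. *)
Definition fps := nat -> F.

Definition fps_monom (c : F) (m : nat) : fps := fun n => if n == m then c else 0.
Definition fps_scale (c : F) (f : fps) : fps := fun n => c * f n.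
Definition fps_sub (f g : fps) : fps := fun n => f n - g n.
Definition fps_mul (f g : fps) : fps := fun n => \sum_(i < n.+1) f i * g (n - i)%N.

(* The first n coefficients of f / g, by long division. *)
Fixpoint fps_div_seq (f g : fps) (n : nat) : seq F :=
  if n is m.+1 then
    let h := fps_div_seq f g m in
    rcons h ((f m - \sum_(i < m) h`_i * g (m - i)%N) / g 0)
  else [::].

(* Meaningful only when g 0 != 0; see fps_divK. *)
Definition fps_div (f g : fps) : fps := fun n => (fps_div_seq f g n.+1)`_n.

Lemma size_fps_div_seq f g n : size (fps_div_seq f g n) = n.
Proof. by elim: n => //= n IHn; rewrite size_rcons IHn. Qed.

Lemma nth_fps_div_seq f g n i : (i < n)%N -> (fps_div_seq f g n)`_i = fps_div f g i.
Proof.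
elim: n => // n IHn; rewrite ltnS leq_eqVlt => /orP[/eqP->//|lt_in].
by rewrite /= nth_rcons size_fps_div_seq lt_in IHn.
Qed.

Lemma fps_divE f g n :
  fps_div f g n = (f n - \sum_(i < n) fps_div f g i * g (n - i)%N) / g 0.
Proof.
rewrite {1}/fps_div /= nth_rcons size_fps_div_seq ltnn eqxx.
by under eq_bigr do rewrite nth_fps_div_seq //.
Qed.

Lemma fps_divK f g : g 0 != 0 -> fps_mul (fps_div f g) g =1 f.
Proof.
move=> g0 n; rewrite /fps_mul big_ord_recr /= subnn [X in X * g 0]fps_divE.
by rewrite divfK // addrC subrK.
Qed.

Definition qpoch (q : F) (n : nat) : F := \prod_(1 <= i < n.+1) (1 - q ^+ i).

(* The series e(x z; q) in z. *)
Definition qexp (q x : F) : fps := fun n => x ^+ n / qpoch q n.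

(* e(t z; q) - t e(z; q), with constant term 1 - t. *)
Definition euler_den (t q : F) : fps :=
  fps_sub (qexp q t) (fps_scale t (qexp q 1)).

Definition qr_eulerian (t r q : F) (n : nat) : F :=
  qpoch q n * fps_div (fps_scale (1 - t) (qexp q r)) (euler_den t q) n.

Definition q_eulerian (t q : F) (n : nat) : F := qr_eulerian t 1 q n.

Definition restricted_gf (j : nat) (t q : F) : fps :=
  fps_mul
    (fps_monom (q_eulerian t q j.-1 * q ^+ j.-1 / qpoch q j.-1) j.-1)
    (fps_div (fps_sub (qexp q t) (fps_scale t (qexp q t))) (euler_den t q)).

Definition restricted_q_eulerian (n j : nat) (t q : F) : F :=
  qpoch q n.-1 * restricted_gf j t q n.-1.

End PowerSeries.

(* The field Q(q) and its generator. *)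
Definition Qq : fieldType := {fraction {poly rat}}.
Definition qvar : Qq := tofrac 'X.

(* The field Q(q)(t), in which the defining quotients of power series are
   taken: their denominators have constant term 1 - t, a unit here but not in
   Q(q)[t]. *)
Definition Qqt : fieldType := {fraction {poly Qq}}.
Definition tvar : Qqt := tofrac 'X.
Definition cst (x : Qq) : Qqt := tofrac x%:P.

Section Polynomiality.

Definition is_tpoly (x : Qqt) := exists p : {poly Qq}, x = tofrac p.

Lemma is_tpoly_cst x : is_tpoly (cst x).
Proof. by exists x%:P. Qed.

Lemma is_tpoly_tvar : is_tpoly tvar.
Proof. by exists 'X. Qed.

Lemma is_tpolyB x y : is_tpoly x -> is_tpoly y -> is_tpoly (x - y).
Proof. by move=> [a ->] [b ->]; exists (a - b); rewrite rmorphB. Qed.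

Lemma is_tpolyD x y : is_tpoly x -> is_tpoly y -> is_tpoly (x + y).
Proof. by move=> [a ->] [b ->]; exists (a + b); rewrite rmorphD. Qed.

Lemma is_tpolyM x y : is_tpoly x -> is_tpoly y -> is_tpoly (x * y).
Proof. by move=> [a ->] [b ->]; exists (a * b); rewrite rmorphM. Qed.

Lemma is_tpoly_sum n (f : 'I_n -> Qqt) :
  (forall i, is_tpoly (f i)) -> is_tpoly (\sum_i f i).
Proof.
move=> fP; apply: (big_ind is_tpoly) => //; last exact: is_tpolyD.
by exists 0; rewrite rmorph0.
Qed.

Lemma is_tpolyX x n : is_tpoly x -> is_tpoly (x ^+ n).
Proof. by move=> [a ->]; exists (a ^+ n); rewrite rmorphXn. Qed.

Lemma cst_is_monoid_morphism : monoid_morphism cst.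
Proof. by split=> [|x y]; rewrite /cst ?polyCM ?rmorphM // polyC1 rmorph1. Qed.

Lemma cst_is_zmod_morphism : zmod_morphism cst.
Proof. by move=> x y; rewrite /cst polyCB rmorphB. Qed.

HB.instance Definition _ := GRing.isZmodMorphism.Build Qq Qqt cst
  cst_is_zmod_morphism.
HB.instance Definition _ := GRing.isMonoidMorphism.Build Qq Qqt cst
  cst_is_monoid_morphism.

Lemma qpoch_cst n : qpoch (cst qvar) n = cst (qpoch qvar n).
Proof.
rewrite /qpoch rmorph_prod; apply: eq_bigr => i _.
by rewrite rmorphB rmorph1 rmorphXn.
Qed.

Lemma is_tpoly_qpoch n : is_tpoly (qpoch (cst qvar) n).
Proof. by rewrite qpoch_cst; apply: is_tpoly_cst. Qed.

Lemma is_tpoly_qpochV n : is_tpoly (qpoch (cst qvar) n)^-1.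
Proof. by rewrite qpoch_cst -fmorphV; apply: is_tpoly_cst. Qed.

Lemma is_tpoly_qexp x n : is_tpoly x -> is_tpoly (qexp (cst qvar) x n).
Proof.
by move=> xP; apply: is_tpolyM; [apply: is_tpolyX | apply: is_tpoly_qpochV].
Qed.

Lemma tvar_neq1 : 1 - tvar != 0.
Proof.
rewrite subr_eq0 -(rmorph1 (@tofrac {poly Qq})) tofrac_eq.
by apply/eqP => /(congr1 (fun p : {poly Qq} => p`_0)) /eqP; rewrite coef1 coefX oner_eq0.
Qed.

Lemma euler_den0 : euler_den tvar (cst qvar) 0 = 1 - tvar.
Proof.
rewrite /euler_den /fps_sub /fps_scale /qexp /qpoch !big_geq //.
by rewrite !expr0 !divr1 mulr1.
Qed.

Lemma euler_den_dvd m : exists2 x, is_tpoly x &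
  euler_den tvar (cst qvar) m.+1 = (1 - tvar) * x.
Proof.
exists (- (\sum_(i < m) tvar ^+ i.+1) / qpoch (cst qvar) m.+1).
  apply: is_tpolyM; last exact: is_tpoly_qpochV.
  rewrite -sub0r; apply: is_tpolyB; first by exists 0; rewrite rmorph0.
  by apply: is_tpoly_sum => i; apply: is_tpolyX; apply: is_tpoly_tvar.
rewrite /euler_den /fps_sub /fps_scale /qexp expr1n mul1r -mulrBl mulrA.
congr (_ / _); rewrite mulrN -mulNr opprB.
under eq_bigr do rewrite exprS.
by rewrite -mulr_sumr mulrCA -subrX1 mulrBr mulr1 -exprS.
Qed.

Lemma is_tpoly_div f n : (forall m, is_tpoly (f m)) ->
  is_tpoly (fps_div (fps_scale (1 - tvar) f) (euler_den tvar (cst qvar)) n).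
Proof.
move=> fP; elim/ltn_ind: n => n IHn; rewrite fps_divE euler_den0.
rewrite mulrBl mulr_suml /fps_scale mulrAC divff ?tvar_neq1 // mul1r.
apply: is_tpolyB => //; apply: is_tpoly_sum => i.
have : (0 < n - i)%N by rewrite subn_gt0.
case: (n - i)%N => // m _; have [x xP ->] := euler_den_dvd m.
rewrite mulrCA mulrAC divff ?tvar_neq1 // mul1r.
by apply: is_tpolyM => //; apply: IHn.
Qed.

Lemma eq_fps_div (F : fieldType) (f f' g : fps F) :
  f =1 f' -> fps_div f g =1 fps_div f' g.
Proof.
move=> ff' n; elim/ltn_ind: n => n IHn; rewrite !fps_divE ff'.
by congr ((_ - _) / _); apply: eq_bigr => i _; rewrite IHn.
Qed.

Lemma restricted_q_eulerian_poly n j :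
  exists p : {poly Qq}, tofrac p == restricted_q_eulerian n j tvar (cst qvar).
Proof.
suff [p ->] : is_tpoly (restricted_q_eulerian n j tvar (cst qvar)) by exists p.
apply: is_tpolyM; first exact: is_tpoly_qpoch.
apply: is_tpoly_sum => i; apply: is_tpolyM.
  rewrite /fps_monom; case: ifP => _; last by exists 0; rewrite rmorph0.
  apply: is_tpolyM; last exact: is_tpoly_qpochV.
  apply: is_tpolyM; last by apply: is_tpolyX; apply: is_tpoly_cst.
  apply: is_tpolyM; first exact: is_tpoly_qpoch.
  apply: is_tpoly_div => m; apply: is_tpoly_qexp.
  by exists 1; rewrite rmorph1.
rewrite (@eq_fps_div _ _ (fps_scale (1 - tvar) (qexp (cst qvar) tvar))).
  by apply: is_tpoly_div => m; apply: is_tpoly_qexp; apply: is_tpoly_tvar.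
by move=> m; rewrite /fps_scale /fps_sub mulrBl mul1r.
Qed.

End Polynomiality.

(* B_n^(j)(t, q) as a polynomial in t over Q(q): the unique preimage under the
   embedding of Q(q)[t] into Q(q)(t). *)
Definition restricted_q_eulerian_tpoly (n j : nat) : {poly Qq} :=
  xchoose (restricted_q_eulerian_poly n j).

Lemma restricted_q_eulerian_tpolyE n j :
  tofrac (restricted_q_eulerian_tpoly n j) =
  restricted_q_eulerian n j tvar (cst qvar).
Proof. exact/eqP/(xchooseP (restricted_q_eulerian_poly n j)). Qed.

Definition restricted_q_eulerian_number (n j k : nat) : Qq :=
  (restricted_q_eulerian_tpoly n j)`_k.

Section PermutationStatistics.
Variable n : nat.

(* Positions and values of s : 'S_n are shifted down by one: the permutation
   of {1, ..., n} it encodes maps i + 1 to s i + 1. *)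
Implicit Type s : 'S_n.

(* Permutations with j |-> n, in 1-based numbering. *)
Definition perms_max_at (j : nat) : {set 'S_n} :=
  [set s : 'S_n | [exists i : 'I_n, (i.+1 == j) && ((s i).+1 == n)]].

Definition des s : nat :=
  #|[set i : 'I_n | [exists i' : 'I_n, (i' == i.+1 :> nat) && (s i' < s i)%N]]|.

(* The inversion (s i, s j) is recorded by its pair of positions (i, j). *)
Definition is_inversion s (i j : 'I_n) : bool := (i < j)%N && (s j < s i)%N.

Definition is_admissible s (i j : 'I_n) : bool :=
  [exists i' : 'I_n, (i == i'.+1 :> nat) && (s i' < s i)%N]
  || [exists l : 'I_n, [&& (i < l)%N, (l < j)%N & (s i < s l)%N]].

Definition ai s : nat :=
  #|[set p : 'I_n * 'I_n | is_inversion s p.1 p.2 && is_admissible s p.1 p.2]|.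

End PermutationStatistics.

(* Main.v *)
Require Import Defs.
From HB Require Import structures.
From mathcomp Require Import all_boot all_order all_algebra all_fingroup.
From mathcomp Require Import boolp ring.

(** Cut a permutation of {1, ..., n} at its maximum n, sitting in position j, into
   u n v. The descents of u n v are those of u, those of v, and one more if v is
   not empty. As for admissible inversions, n stands between every letter of u
   and every letter of v and exceeds both, so all inversions between u and v are
   admissible; those inside u or inside v keep their status; and if u is not
   empty, n forms an admissible inversion with each of the n - j letters of v
   ([word_ai_peak]). The letters of u form an arbitrary (j - 1)-subset of
   {1, ..., n - 1}, and the inversions between u and v are counted by a q-binomial
   coefficient ([sum_splits_cross_inv]). So if P_m is the sum of
   t^des q^ai over the words on m distinct letters, then for j >= 2 the
   permutations with n in position j contribute
     q^(n - j) [n - 1 choose j - 1]_q P_(j - 1) D_(n - j),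
   where D_0 = 1 and D_m = t P_m for m > 0 ([sum_weight_max_at]); for j = 1 they
   contribute D_(n - 1). Adding up over j gives a recursion for P_n.

   On the series side put E = e(tz) - t e(z), A(z) = (1 - t) e(z) / E and
   D(z) = (1 - t) e(tz) / E = 1 - t + t A(z). The equation e(qz) = (1 - z) e(z)
   yields
     A(z) - A(qz) = z (D(z) + (A(z) - 1) D(qz)),
   see [eulerian_fps_dilate], and comparing coefficients gives the same recursion
   for the q-Eulerian polynomials ([q_eulerian_rec]). Hence P_m = A_m(t, q)
   ([sum_weight_permutations]), and the contribution of a position
   j >= 2, times q^(2j - n - 1), is the coefficient that defines the restricted polynomial
   ([restricted_q_eulerianE]).

   Permutations are handled as words, that is, duplicate-free sequences of natural
   numbers. Letting the alphabet be any decreasing sequence lets the induction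
   apply to u and v directly, without relabelling their letters. *)

Set Implicit Arguments.
Unset Strict Implicit.
Unset Printing Implicit Defensive.

Import GRing.Theory.
Local Open Scope ring_scope.

(** * The ring of formal power series *)

Section FpsRing.
Variable F : fieldType.
Implicit Types f g h : fps F.

Definition fps_add f g : fps F := fun n => f n + g n.
Definition fps_opp f : fps F := fun n => - f n.

(* A ring structure presupposes equality and choice structures, which on a type
   of sequences only exist classically. *)
HB.instance Definition _ := gen_eqMixin (fps F).
HB.instance Definition _ := gen_choiceMixin (fps F).

Lemma fps_addA : associative fps_add.
Proof. by move=> f g h; apply: funext => n; apply: addrA. Qed.

Lemma fps_addC : commutative fps_add.
Proof. by move=> f g; apply: funext => n; apply: addrC. Qed.

Lemma fps_add0 : left_id (fps_monom 0 0) fps_add.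
Proof. by move=> f; apply: funext => n; rewrite /fps_add /fps_monom if_same add0r. Qed.

Lemma fps_addN : left_inverse (fps_monom 0 0) fps_opp fps_add.
Proof.
by move=> f; apply: funext => n; rewrite /fps_add /fps_opp addNr /fps_monom if_same.
Qed.

HB.instance Definition _ :=
  GRing.isZmodule.Build (fps F) fps_addA fps_addC fps_add0 fps_addN.

(** The n-th coefficient of a product only sees coefficients up to n, so the ring
   axioms for the product of series follow from those for polynomials. *)
Definition fps_trunc f m : {poly F} := \poly_(i < m) f i.

Lemma coef_fps_trunc f m n : (n < m)%N -> (fps_trunc f m)`_n = f n.
Proof. by move=> nm; rewrite coef_poly nm. Qed.

Lemma coefM_eq (p p' r r' : {poly F}) m :
  (forall i, (i < m)%N -> p`_i = p'`_i) -> (forall i, (i < m)%N -> r`_i = r'`_i) ->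
  forall i, (i < m)%N -> (p * r)`_i = (p' * r')`_i.
Proof.
move=> pp' rr' n nm; rewrite !coefM; apply: eq_bigr => i _.
by rewrite pp' ?rr' // (leq_ltn_trans _ nm) ?leq_subr // -ltnS.
Qed.

Lemma fps_mulE f g m n : (n < m)%N ->
  fps_mul f g n = (fps_trunc f m * fps_trunc g m)`_n.
Proof.
move=> nm; rewrite coefM; apply: eq_bigr => i _.
by rewrite !coef_fps_trunc // (leq_ltn_trans _ nm) ?leq_subr // -ltnS.
Qed.

Lemma coef_fps_trunc_mul f g m n : (n < m)%N ->
  (fps_trunc (fps_mul f g) m)`_n = (fps_trunc f m * fps_trunc g m)`_n.
Proof. by move=> nm; rewrite coef_fps_trunc // (fps_mulE _ _ nm). Qed.

Lemma fps_mulC : commutative (@fps_mul F).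
Proof.
by move=> f g; apply: funext => n; rewrite !(fps_mulE _ _ (ltnSn n)) mulrC.
Qed.

Lemma fps_mulA : associative (@fps_mul F).
Proof.
move=> f g h; apply: funext => n; rewrite !(fps_mulE _ _ (ltnSn n)).
transitivity (fps_trunc f n.+1 * (fps_trunc g n.+1 * fps_trunc h n.+1))`_n.
  by apply: coefM_eq (ltnSn n) => // i; apply: coef_fps_trunc_mul.
rewrite mulrA; apply/esym.
by apply: coefM_eq (ltnSn n) => // i; apply: coef_fps_trunc_mul.
Qed.

Lemma fps_mul1 : left_id (fps_monom 1 0) (@fps_mul F).
Proof.
move=> f; apply: funext => n; rewrite /fps_mul big_ord_recl /= subn0 mul1r.
by rewrite big1 ?addr0 // => i _; rewrite /fps_monom mul0r.
Qed.

Lemma fps_mulDl : left_distributive (@fps_mul F) fps_add.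
Proof.
move=> f g h; apply: funext => n; rewrite /fps_mul /fps_add -big_split.
by apply: eq_bigr => i _; rewrite mulrDl.
Qed.

Lemma fps_one_neq0 : fps_monom (1 : F) 0 != 0.
Proof. by apply/eqP => /(congr1 (@^~ 0%N)) /eqP; rewrite /= oner_eq0. Qed.

HB.instance Definition _ := GRing.Zmodule_isComNzRing.Build (fps F)
  fps_mulA fps_mulC fps_mul1 fps_mulDl fps_one_neq0.

Lemma fpsD f g n : (f + g) n = f n + g n. Proof. by []. Qed.
Lemma fpsB f g n : (f - g) n = f n - g n. Proof. by []. Qed.
Lemma fpsM f g n : (f * g) n = \sum_(i < n.+1) f i * g (n - i)%N. Proof. by []. Qed.

Lemma fps1 n : (1 : fps F) n = (n == 0%N)%:R.
Proof. by rewrite /GRing.one /= /fps_monom; case: eqP. Qed.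

Lemma fps_monomM c m f n :
  (fps_monom c m * f) n = if (m <= n)%N then c * f (n - m)%N else 0.
Proof.
rewrite fpsM /fps_monom; case: leqP => [mn|nm].
  rewrite (bigD1 (Ordinal (mn : m < n.+1)%N)) //= eqxx big1 ?addr0 // => i.
  by rewrite -val_eqE /= => /negPf ->; rewrite mul0r.
by apply: big1 => i _; rewrite ltn_eqF ?mul0r // (leq_ltn_trans _ nm) // -ltnS.
Qed.

Definition fpsC (c : F) : fps F := fps_monom c 0.

Lemma fpsCM c f n : (fpsC c * f) n = c * f n.
Proof. by rewrite fps_monomM subn0. Qed.

Lemma fpsC_sub1 c : fpsC (1 - c) = 1 - fpsC c.
Proof.
by apply: funext => n; rewrite fpsB fps1 /fpsC /fps_monom; case: eqP; rewrite ?subr0.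
Qed.

(** A factor with nonzero constant term is invertible, hence can be cancelled. *)
Lemma fps_mulIf g f h : g 0%N != 0 -> f * g = h * g -> f = h.
Proof.
move=> g0 fg; apply: funext => n; elim/ltn_ind: n => n IHn.
have /(congr1 (@^~ n)) := fg; rewrite /= !fpsM !big_ord_recr /= subnn.
rewrite (eq_bigr (fun i : 'I_n => h i * g (n - i)%N)) => [|i _]; last by rewrite IHn.
by move=> /addrI /(mulIf g0).
Qed.

(** The substitution of q z for z. *)
Definition fps_dilate (q : F) f : fps F := fun n => q ^+ n * f n.

Lemma fps_dilateM q f g : fps_dilate q (f * g) = fps_dilate q f * fps_dilate q g.
Proof.
apply: funext => n; rewrite /fps_dilate !fpsM mulr_sumr; apply: eq_bigr => i _.
by rewrite mulrACA -exprD subnKC // -ltnS.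
Qed.

Lemma fps_dilateB q f g : fps_dilate q (f - g) = fps_dilate q f - fps_dilate q g.
Proof. by apply: funext => n; rewrite /fps_dilate !fpsB mulrBr. Qed.

Lemma fps_dilateC q c : fps_dilate q (fpsC c) = fpsC c.
Proof.
by apply: funext => n; rewrite /fps_dilate /fpsC /fps_monom; case: eqP => [->|];
   rewrite ?mul1r ?mulr0.
Qed.

End FpsRing.

(** * The recursion of the q-Eulerian polynomials *)

Section EulerianSeries.
Variables (F : fieldType) (q t : F).
Hypothesis qpoch_neq0 : forall n, qpoch q n != 0.
Hypothesis t_neq1 : 1 - t != 0.

Local Notation c := (fpsC (1 - t)).
Local Notation E := (euler_den t q).

Lemma qpoch0 : qpoch q 0 = 1.
Proof. by rewrite /qpoch big_geq. Qed.

Lemma qpochS n : qpoch q n.+1 = qpoch q n * (1 - q ^+ n.+1).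
Proof. by rewrite /qpoch big_nat_recr. Qed.

(** In series: e(x q z) = (1 - x z) e(x z). *)
Lemma fps_dilate_qexp x :
  fps_dilate q (qexp q x) = (1 - fps_monom x 1) * qexp q x.
Proof.
apply: funext => n; rewrite mulrBl mul1r fpsB fps_monomM /fps_dilate /qexp.
case: n => [|n]; first by rewrite subr0 expr0 mul1r.
have := qpoch_neq0 n.+1; rewrite qpochS mulf_eq0 !exprS => /norP[n0 qn0].
by rewrite subn1 /=; field; rewrite n0 qn0.
Qed.

Lemma euler_denE : E = qexp q t - fpsC t * qexp q 1.
Proof. by apply: funext => n; rewrite fpsB fpsCM. Qed.

Lemma euler_den_coef0 : E 0%N = 1 - t.
Proof. by rewrite /euler_den /fps_sub /fps_scale /qexp qpoch0 !expr0 divr1 mulr1. Qed.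

Lemma euler_den_neq0 : E 0%N != 0.
Proof. by rewrite euler_den_coef0. Qed.

Definition eulerian_fps : fps F := fps_div (fps_scale (1 - t) (qexp q 1)) E.

(** The quotient that multiplies the leading monomial in [restricted_gf]. *)
Definition restricted_fps : fps F :=
  fps_div (fps_sub (qexp q t) (fps_scale t (qexp q t))) E.

Lemma eulerian_fpsK : eulerian_fps * E = c * qexp q 1.
Proof.
apply: funext => n; rewrite fpsCM -[RHS]/(fps_scale (1 - t) (qexp q 1) n).
exact: (fps_divK _ euler_den_neq0).
Qed.

Lemma restricted_fpsK : restricted_fps * E = c * qexp q t.
Proof.
apply: funext => n; rewrite fpsCM mulrBl mul1r.
rewrite -[RHS]/(fps_sub (qexp q t) (fps_scale t (qexp q t)) n).
exact: (fps_divK _ euler_den_neq0).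
Qed.

Lemma restricted_fpsE : restricted_fps = c + fpsC t * eulerian_fps.
Proof.
apply: (fps_mulIf euler_den_neq0).
rewrite mulrDl -mulrA eulerian_fpsK restricted_fpsK euler_denE fpsC_sub1.
ring.
Qed.

(** Substituting the functional equations of e(z) and e(tz) and clearing both
   denominators turns this into a polynomial identity. *)
Lemma eulerian_fps_dilate :
  eulerian_fps - fps_dilate q eulerian_fps =
  fps_monom 1 1 *
    (restricted_fps + (eulerian_fps - 1) * fps_dilate q restricted_fps).
Proof.
set A := eulerian_fps; set D := restricted_fps.
set Aq := fps_dilate q A; set Dq := fps_dilate q D; set Eq := fps_dilate q E.
have AE := eulerian_fpsK; have DE := restricted_fpsK.
rewrite -/A -/D in AE DE.
have monomt : fps_monom t 1 = fpsC t * fps_monom 1 1.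
  by apply: funext => n; rewrite fpsCM /fps_monom; case: eqP; rewrite ?mulr1 ?mulr0.
have AEq : Aq * Eq = c * ((1 - fps_monom 1 1) * qexp q 1).
  by rewrite -fps_dilateM AE fps_dilateM fps_dilateC fps_dilate_qexp.
have DEq : Dq * Eq = c * ((1 - fps_monom t 1) * qexp q t).
  by rewrite -fps_dilateM DE fps_dilateM fps_dilateC fps_dilate_qexp.
have EqE : Eq = (1 - fps_monom t 1) * qexp q t
                - fpsC t * ((1 - fps_monom 1 1) * qexp q 1).
  by rewrite /Eq euler_denE fps_dilateB fps_dilateM fps_dilateC !fps_dilate_qexp.
have Eq0 : Eq 0%N != 0 by rewrite /Eq /fps_dilate mul1r euler_den_coef0.
apply: (fps_mulIf Eq0); apply: (fps_mulIf euler_den_neq0).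
transitivity (A * E * Eq - Aq * Eq * E); first by ring.
transitivity (fps_monom 1 1 * (D * E * Eq + (A * E - E) * (Dq * Eq))); last by ring.
rewrite AE DE AEq DEq EqE euler_denE monomt fpsC_sub1.
ring.
Qed.

Definition restricted_tail m : F := qpoch q m * restricted_fps m.

Lemma q_eulerianE n : q_eulerian t q n = qpoch q n * eulerian_fps n.
Proof. by []. Qed.

Lemma q_eulerian0 : q_eulerian t q 0 = 1.
Proof.
rewrite q_eulerianE qpoch0 mul1r /eulerian_fps fps_divE big_ord0 subr0.
by rewrite euler_den_coef0 /fps_scale /qexp qpoch0 divr1 mulr1 divff.
Qed.

(** The polynomial D_m: a letter before a nonempty word and above all of its
   letters makes one more descent, whence the factor t. *)
Lemma restricted_tailE m :
  restricted_tail m = if m is 0 then 1 else t * q_eulerian t q m.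
Proof.
rewrite /restricted_tail restricted_fpsE fpsD fpsCM mulrDr mulrCA -q_eulerianE.
case: m => [|m]; first by rewrite q_eulerian0 qpoch0 mul1r mulr1 subrK.
by rewrite /fpsC /fps_monom mulr0 add0r.
Qed.

Definition qbinom n i : F := qpoch q n / (qpoch q i * qpoch q (n - i)%N).

(** The coefficient of z^(n + 1) in [eulerian_fps_dilate]. The power of q drops out
   at i = 0 because that term comes from the summand D(z), not from D(qz). *)
Lemma q_eulerian_rec n :
  q_eulerian t q n.+1 =
  \sum_(i < n.+1) qbinom n i * q ^+ (if i == 0%N :> nat then 0 else n - i)%N *
    (q_eulerian t q i * restricted_tail (n - i)%N).
Proof.
have /(congr1 (@^~ n.+1)) := eulerian_fps_dilate.
rewrite /= fps_monomM /= mul1r subn1 /= fpsB fpsD fpsM /fps_dilate.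
rewrite -{1}[eulerian_fps n.+1]mul1r -mulrBl => recE.
rewrite q_eulerianE qpochS -mulrA recE big_ord_recl /= subn0.
rewrite fpsB fps1 -[eulerian_fps 0]mul1r -{1}qpoch0 -q_eulerianE q_eulerian0.
rewrite subrr mul0r add0r mulrDr [RHS]big_ord_recl /= subn0.
rewrite expr0 mulr1 q_eulerian0 mul1r /qbinom qpoch0 mul1r subn0 divff // mul1r.
congr (_ + _); rewrite mulr_sumr; apply: eq_bigr => i _.
rewrite fpsB fps1 subr0 q_eulerianE /restricted_tail /bump /=.
by field; rewrite !qpoch_neq0.
Qed.

Lemma qbinom0 n : qbinom n 0 = 1.
Proof. by rewrite /qbinom qpoch0 mul1r subn0 divff. Qed.

Lemma qbinomn n : qbinom n n = 1.
Proof. by rewrite /qbinom subnn qpoch0 mulr1 divff. Qed.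

(** The q-Pascal rule. *)
Lemma qbinomS n i : (i < n)%N ->
  qbinom n.+1 i.+1 = q ^+ (n - i) * qbinom n i + qbinom n i.+1.
Proof.
move=> lt_in; rewrite /qbinom subSS.
have [m ->] : exists m, n = (i + m).+1.
  by exists (n - i.+1)%N; rewrite -addSn subnKC.
rewrite -addnS addKn addnS subSS addKn.
have := qpoch_neq0 i.+1; have := qpoch_neq0 m.+1; rewrite !qpochS.
rewrite !mulf_eq0 => /norP[m0 m1] /norP[i0 i1].
have -> : q ^+ (i + m).+2 = q ^+ i.+1 * q ^+ m.+1 by rewrite -exprD addnS.
by field; rewrite m0 m1 i0 i1.
Qed.

End EulerianSeries.

(** * Descents and admissible inversions of words *)

Section WordStatistics.
Local Open Scope nat_scope.
Implicit Types (w u v : seq nat).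

(** Here p is the letter that precedes w. *)
Fixpoint des_from p w :=
  if w is x :: w' then (x < p) + des_from x w' else 0.

(** A word starts as if preceded by its own first letter, which makes neither a
   descent nor an ascent there. *)
Definition word_des w := des_from (head 0 w) w.

(** Counts the admissible inversions of a letter x with the letters of the word v
   that follows it. The flag b records whether they are admissible so far: it is
   initially set when x follows a smaller letter, and it gets set as soon as a
   letter above x has been read. *)
Fixpoint adm_inv (b : bool) x v :=
  if v is y :: v' then (b && (y < x)) + adm_inv (b || (x < y)) x v' else 0.

Fixpoint ai_from p w :=
  if w is x :: w' then adm_inv (p < x) x w' + ai_from x w' else 0.

Definition word_ai w := ai_from (head 0 w) w.

Definition cross_inv u v := \sum_(x <- u) count (gtn x) v.

Lemma adm_inv_true x v : adm_inv true x v = count (gtn x) v.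
Proof. by elim: v => //= y v ->. Qed.

Lemma adm_inv_none b m v : all (gtn m) v -> adm_inv b m v = if b then size v else 0.
Proof.
case: b => [vm|]; first by rewrite adm_inv_true; apply/eqP; rewrite -all_count.
by elim: v => //= y v IHv /andP[ym /IHv]; rewrite ltnNge ltnW //= => ->.
Qed.

Lemma adm_inv_peak b x u m v : x < m ->
  adm_inv b x (u ++ m :: v) = adm_inv b x u + count (gtn x) v.
Proof.
move=> xm; elim: u b => [|y u IHu] b /=; last by rewrite IHu addnA.
by rewrite xm orbT adm_inv_true ltnNge ltnW //= andbF.
Qed.

Lemma des_from_cat p u v :
  des_from p (u ++ v) = des_from p u + des_from (last p u) v.
Proof. by elim: u p => //= x u IHu p; rewrite IHu addnA. Qed.

Lemma ai_from_peak p u m v : all (gtn m) u ->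
  ai_from p (u ++ m :: v) = ai_from p u + cross_inv u v + ai_from (last p u) (m :: v).
Proof.
elim: u p => [|x u IHu] p; first by rewrite /cross_inv big_nil.
rewrite [all _ _]/= => /andP[xm um]; rewrite [LHS]/= IHu // adm_inv_peak //.
by rewrite /cross_inv big_cons /= -!addnA; congr (_ + _); rewrite addnCA.
Qed.

Lemma des_from_desc m v : all (gtn m) v ->
  des_from m v = (v != [::]) + word_des v.
Proof. by case: v => //= x v /andP[-> _]; rewrite /word_des /= ltnn. Qed.

Lemma ai_from_desc m v : all (gtn m) v -> ai_from m v = word_ai v.
Proof.
by case: v => //= x v /andP[xm _]; rewrite /word_ai /= ltnn ltnNge ltnW.
Qed.

Lemma last_lt p m u : p < m -> all (gtn m) u -> last p u < m.
Proof. by elim: u p => //= x u IHu p _ /andP[xm um]; apply: IHu. Qed.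

Lemma word_des_peak u m v : all (gtn m) u -> all (gtn m) v ->
  word_des (u ++ m :: v) = word_des u + ((v != [::]) + word_des v).
Proof.
move=> um vm; rewrite /word_des des_from_cat /= (des_from_desc vm) addnA.
case: u um => [|x u] /=; first by rewrite ltnn addn0.
by move=> /andP[xm um]; rewrite (ltnNge m) (ltnW (last_lt xm um)) addn0.
Qed.

(** The maximum m separates the word u m v: it makes every inversion between u
   and v admissible, by the second clause, while an inversion inside u or inside
   v keeps its status. The inversions that m itself forms with v are admissible
   exactly when m has a left neighbour. *)
Lemma word_ai_peak u m v : all (gtn m) u -> all (gtn m) v ->
  word_ai (u ++ m :: v) =
  word_ai u + word_ai v + cross_inv u v + (if size u == 0 then 0 else size v).
Proof.
move=> um vm; rewrite {1}/word_ai ai_from_peak // [ai_from _ (m :: v)]/=.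
rewrite (ai_from_desc vm) (adm_inv_none _ vm) -/(word_ai _) /word_ai.
case: u um => [|x u] um; first by rewrite /= ltnn addn0 [RHS]addnC.
rewrite last_lt //=; last by case/andP: um.
by rewrite (addnC (size v)) addnA (addnAC _ _ (ai_from _ v)).
Qed.

Lemma cross_inv_perm u u' v v' :
  perm_eq u u' -> perm_eq v v' -> cross_inv u v = cross_inv u' v'.
Proof.
move=> uu' vv'; rewrite /cross_inv (perm_big _ uu'); apply: eq_bigr => x _.
exact/seq.permP.
Qed.

Lemma cross_inv_consl x u v : all (gtn x) v ->
  cross_inv (x :: u) v = size v + cross_inv u v.
Proof. by rewrite /cross_inv big_cons all_count => /eqP ->. Qed.

Lemma cross_inv_consr x u v : all (gtn x) u -> cross_inv u (x :: v) = cross_inv u v.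
Proof.
move=> /allP ux; rewrite /cross_inv !big_seq; apply: eq_bigr => y /ux /= yx.
by rewrite ltnNge ltnW.
Qed.

End WordStatistics.

(** * Words cut at a letter *)

Section Splits.
Variable T : eqType.
Implicit Types s : seq T.

(** Both parts keep the order of s, so the parts of a decreasing alphabet are again
   decreasing alphabets. *)
Fixpoint splits s : seq (seq T * seq T) :=
  if s is x :: s' then
    [seq (x :: p.1, p.2) | p <- splits s'] ++ [seq (p.1, x :: p.2) | p <- splits s']
  else [:: ([::], [::])].

Lemma splits_perm s p : p \in splits s -> perm_eq (p.1 ++ p.2) s.
Proof.
elim: s p => [|x s IHs] p; first by rewrite inE => /eqP ->.
rewrite mem_cat => /orP[] /mapP[p' /IHs ps ->] /=; first by rewrite perm_cons.
by rewrite -[x :: _.2]cat1s perm_catCA perm_cons.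
Qed.

Lemma splits_subseq s p : p \in splits s -> subseq p.1 s /\ subseq p.2 s.
Proof.
elim: s p => [|x s IHs] p; first by rewrite inE => /eqP ->.
have skip (u : seq T) : subseq u s -> subseq u (x :: s).
  by move=> us; apply: subseq_trans us (subseq_cons _ _).
rewrite mem_cat => /orP[] /mapP[p' /IHs[ps1 ps2] ->].
  by split; [rewrite /= eqxx | apply: skip].
by split; [apply: skip | rewrite /= eqxx].
Qed.

Lemma filter_splits (a : pred T) s : (filter a s, filter (predC a) s) \in splits s.
Proof.
elim: s => //= x s IHs; rewrite mem_cat; apply/orP.
by case: (a x); [left | right]; apply/mapP; exists (filter a s, filter (predC a) s).
Qed.

Lemma splitsE s p : uniq s -> p \in splits s ->
  p = (filter (mem p.1) s, filter (predC (mem p.1)) s).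
Proof.
move=> us ps; have [p1s p2s] := splits_subseq ps.
have uc : uniq (p.1 ++ p.2) by rewrite (perm_uniq (splits_perm ps)).
case: p ps p1s p2s uc => u v /= ps /(subseq_uniqP us) Eu /(subseq_uniqP us) Ev uc.
congr (_, _) => //; rewrite {1}Ev; apply: eq_in_filter => x xs /=.
have := perm_mem (splits_perm ps) x; rewrite xs mem_cat /=.
move: uc; rewrite cat_uniq => /and3P[_ /hasPn dis _].
case xu: (x \in u) => //= _.
by apply/negP => /dis /=; rewrite xu.
Qed.

Lemma splits_uniq s : uniq s -> uniq (splits s).
Proof.
elim: s => //= x s IHs /andP[xs us]; rewrite cat_uniq !map_inj_uniq ?IHs //; last 2 first.
- by move=> [u v] [u' v'] [-> ->].
- by move=> [u v] [u' v'] [-> ->].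
rewrite andbT; apply/hasPn => _ /mapP[p ps ->]; apply/mapP => -[p' _ [Ep _]].
have [/mem_subseq sub _] := splits_subseq ps.
by case/negP: xs; apply: sub; rewrite Ep mem_head.
Qed.

(** A duplicate-free word containing m determines its cut at m, and the sets of
   letters on the two sides determine the split of s. *)
Lemma perm_permutations_splits m s : uniq (m :: s) ->
  perm_eq (permutations (m :: s))
    [seq p.1 ++ m :: p.2 | d <- splits s,
       p <- [seq (u, v) | u <- permutations d.1, v <- permutations d.2]].
Proof.
move=> /= /andP[ms us]; apply: uniq_perm; first exact: permutations_uniq.
- apply: allpairs_uniq_dep; first exact: splits_uniq.
    move=> d _; apply: allpairs_uniq; rewrite ?permutations_uniq //.
    by move=> [? ?] [? ?].
  move=> _ _ /allpairsPdep[d [_ [ds /allpairsP[[u v] [/= ud vd ->]] ->]]]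
    /allpairsPdep[d' [_ [d's /allpairsP[[u' v'] [/= ud' vd' ->]] ->]]] /= Ew.
  rewrite !mem_permutations in ud vd ud' vd'.
  have notin e w : e \in splits s -> perm_eq w e.1 -> m \notin w.
    move=> es we; rewrite (perm_mem we); have [/mem_subseq sub _] := splits_subseq es.
    by apply: contra ms; apply: sub.
  have mu := notin _ _ ds ud; have mu' := notin _ _ d's ud'.
  have sz : size u = size u'.
    have := congr1 (index m) Ew; rewrite !index_cat (negPf mu) (negPf mu') /= eqxx.
    by rewrite !addn0.
  move/eqP: Ew; rewrite eqseq_cat // eqseq_cons eqxx /= => /andP[/eqP Eu /eqP Ev].
  have Ed : d = d'.
    rewrite (splitsE us ds) (splitsE us d's).
    have eqm : mem d.1 =i mem d'.1.
      by move=> x; rewrite /= -(perm_mem ud) -(perm_mem ud') Eu.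
    by congr (_, _); apply: eq_filter => x /=; have := eqm x; rewrite /= => ->.
  by rewrite Ed Eu Ev.
move=> w; rewrite mem_permutations; apply/idP/allpairsPdep.
  move=> wp; have mw : m \in w by rewrite (perm_mem wp) mem_head.
  case/splitPr: mw wp => u v; rewrite -cat_rcons.
  rewrite (permPl (_ : perm_eq _ (m :: u ++ v))); last first.
    by rewrite cat_rcons -cat1s perm_catCA.
  rewrite perm_cons => uvs.
  have uuv : uniq (u ++ v) by rewrite (perm_uniq uvs).
  exists (filter (mem u) s, filter (predC (mem u)) s), (u, v).
  split; rewrite ?cat_rcons //; first exact: filter_splits.
  move: (uuv); rewrite cat_uniq => /and3P[uu /hasPn dis uv].
  apply/allpairsP; exists (u, v); rewrite /= !mem_permutations; split=> //.
  + apply: uniq_perm; rewrite ?filter_uniq // => x; rewrite mem_filter /=.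
    by rewrite -(perm_mem uvs) mem_cat; case: (x \in u).
  apply: uniq_perm; rewrite ?filter_uniq // => x; rewrite mem_filter /=.
  rewrite -(perm_mem uvs) mem_cat; case xu: (x \in u) => //=.
  by apply/negP => /dis /=; rewrite xu.
move=> [d [_ [ds /allpairsP[[u v] [/= ud vd ->]] ->]]] /=.
rewrite !mem_permutations in ud vd.
rewrite -[m :: v]cat1s perm_catCA perm_cons.
by rewrite (permPl (perm_cat ud vd)) splits_perm.
Qed.

End Splits.

(** * Enumeration of words by descents and admissible inversions *)

Section WordSums.
Variables (F : fieldType) (q t : F).
Hypothesis qpoch_neq0 : forall n, qpoch q n != 0.
Hypothesis t_neq1 : 1 - t != 0.
Implicit Types (s w u v : seq nat).

Lemma gtn_path m s : path gtn m s = all (gtn m) s && sorted gtn s.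
Proof. by rewrite path_sortedE // => x y z yx zx; apply: ltn_trans zx yx. Qed.

Lemma sorted_gtn_uniq s : sorted gtn s -> uniq s.
Proof.
by apply: sorted_uniq => [x y z yx zx|x]; [apply: ltn_trans zx yx | apply: ltnn].
Qed.

Lemma splits_all (a : pred nat) s d : d \in splits s -> all a s ->
  all a d.1 /\ all a d.2.
Proof. by move=> /splits_perm/perm_all <-; rewrite all_cat => /andP. Qed.

Lemma splits_sorted s d : d \in splits s -> sorted gtn s ->
  sorted gtn d.1 /\ sorted gtn d.2.
Proof.
move=> /splits_subseq[s1 s2] ss.
have tr : transitive gtn by move=> x y z yx zx; apply: ltn_trans zx yx.
by split; [apply: subseq_sorted s1 ss | apply: subseq_sorted s2 ss].
Qed.

Lemma splits_size2 s d : d \in splits s -> size d.2 = (size s - size d.1)%N.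
Proof. by move=> /splits_perm/perm_size <-; rewrite size_cat addKn. Qed.

(** A new maximum makes an inversion with every letter of the right part if it
   joins the left part, and none if it joins the right part: these are the two
   terms of the q-Pascal rule. *)
Lemma sum_splits_cross_inv s i : sorted gtn s -> (i <= size s)%N ->
  \sum_(d <- splits s | size d.1 == i) q ^+ cross_inv d.1 d.2 = qbinom q (size s) i.
Proof.
elim: s i => [|x s IHs] i.
  rewrite leqn0 => _ /eqP -> /=.
  by rewrite big_cons big_nil /cross_inv big_nil /= addr0 qbinom0.
rewrite /= gtn_path => /andP[xs ss] is_le; rewrite big_cat !big_map /=.
have -> : \sum_(d <- splits s | size d.1 == i) q ^+ cross_inv d.1 (x :: d.2) =
          \sum_(d <- splits s | size d.1 == i) q ^+ cross_inv d.1 d.2.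
  rewrite !(big_seq_cond (fun d => size d.1 == i)); apply: eq_bigr => d /andP[ds _].
  by rewrite cross_inv_consr //; have [] := splits_all ds xs.
case: i is_le => [|i] is_le; first by rewrite big_pred0_eq add0r IHs // !qbinom0.
have -> : \sum_(d <- splits s | (size d.1).+1 == i.+1) q ^+ cross_inv (x :: d.1) d.2 =
    q ^+ (size s - i) * \sum_(d <- splits s | size d.1 == i) q ^+ cross_inv d.1 d.2.
  rewrite mulr_sumr !(big_seq_cond (fun d => _ == _)).
  apply: eq_bigr => d /andP[ds /eqP[Ei]]; have [_ d2x] := splits_all ds xs.
  by rewrite cross_inv_consl // exprD (splits_size2 ds) Ei.
rewrite IHs //; move: is_le; rewrite ltnS leq_eqVlt => /orP[/eqP Ei | lt_is].
  rewrite Ei subnn mul1r big_seq_cond big1 ?addr0 ?qbinomn // => d /andP[ds /eqP szd].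
  by have := perm_size (splits_perm ds); rewrite size_cat szd addSnnS => /eqP;
     rewrite -{2}[size s]addn0 eqn_add2l.
by rewrite IHs // qbinomS.
Qed.

Definition weight w : F := t ^+ word_des w * q ^+ word_ai w.

Lemma weight_peak u m v : all (gtn m) u -> all (gtn m) v ->
  weight (u ++ m :: v) =
  q ^+ (cross_inv u v + if size u == 0%N then 0 else size v)%N *
  (weight u * (t ^+ (v != [::]) * weight v)).
Proof.
move=> um vm; rewrite /weight word_des_peak // word_ai_peak // !exprD.
ring.
Qed.

(** Cut every word at its maximum m, in position i, and sum separately over the
   distribution of the other letters and over the words on either side. The
   enumeration of words on smaller alphabets is assumed, since this is a step of
   the induction that proves it. *)
Lemma sum_weight_max_at m s i : sorted gtn (m :: s) -> (i <= size s)%N ->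
  (forall s', sorted gtn s' -> (size s' <= size s)%N ->
    \sum_(w <- permutations s') weight w = q_eulerian t q (size s')) ->
  \sum_(w <- permutations (m :: s) | index m w == i) weight w =
  qbinom q (size s) i * q ^+ (if i == 0%N then 0 else size s - i)%N *
    (q_eulerian t q i * restricted_tail q t (size s - i)%N).
Proof.
move=> ms_sorted is_le IH.
have := ms_sorted; rewrite /= gtn_path => /andP[ms ss].
rewrite big_mkcond (perm_big _ (perm_permutations_splits (sorted_gtn_uniq ms_sorted))).
rewrite big_allpairs_dep -(sum_splits_cross_inv ss is_le) /= mulr_suml mulr_suml.
rewrite [RHS]big_mkcond big_seq [RHS]big_seq; apply: eq_bigr => d ds.
have [d1m d2m] := splits_all ds ms; have [d1s d2s] := splits_sorted ds ss.
have sz2 := splits_size2 ds.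
rewrite big_allpairs_dep /=.
have wtE u v : u \in permutations d.1 -> v \in permutations d.2 ->
    (if index m (u ++ m :: v) == i then weight (u ++ m :: v) else 0) =
    if size d.1 == i then
      q ^+ cross_inv d.1 d.2 * q ^+ (if i == 0%N then 0 else size s - i)%N *
      (weight u * (t ^+ (d.2 != [::]) * weight v))
    else 0.
  rewrite !mem_permutations => ud vd.
  have um : all (gtn m) u by rewrite (perm_all _ ud).
  have vm : all (gtn m) v by rewrite (perm_all _ vd).
  have mu : m \notin u by apply/negP => /(allP um) /=; rewrite ltnn.
  rewrite index_cat (negPf mu) /= eqxx addn0 (perm_size ud); case: eqP => // szu.
  rewrite weight_peak // (cross_inv_perm ud vd) exprD (perm_size ud) szu.
  rewrite (perm_size vd) sz2 szu; congr (_ * (_ * (t ^+ nat_of_bool _ * _))).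
  by rewrite -!size_eq0 (perm_size vd).
under eq_big_seq => u ud do under eq_big_seq => v vd do rewrite (wtE u v ud vd).
case: eqP => [szd|_]; last by rewrite big1 // => u _; rewrite big1.
under eq_bigr => u _ do rewrite -mulr_sumr -mulr_sumr -mulr_sumr.
rewrite -mulr_sumr -mulr_suml; congr (_ * (_ * _)).
  by rewrite IH ?szd.
rewrite IH // sz2 ?leq_subr // szd restricted_tailE //.
by rewrite -size_eq0 sz2 szd; case: (size s - i)%N => //=; rewrite mul1r q_eulerian0.
Qed.

(** Summing [sum_weight_max_at] over the position of the maximum reproduces the
   recursion [q_eulerian_rec]. *)
Lemma sum_weight_permutations s : sorted gtn s ->
  \sum_(w <- permutations s) weight w = q_eulerian t q (size s).
Proof.
have [n] := ubnP (size s); elim: n s => // n IHn [|m s] szs ss.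
  by rewrite big_cons big_nil q_eulerian0 // /weight mul1r addr0.
rewrite [size _]/= q_eulerian_rec //.
rewrite (partition_big (fun w => inord (index m w) : 'I_(size s).+1) xpredT) //=.
apply: eq_bigr => i _.
rewrite -(@sum_weight_max_at m) //.
- rewrite big_seq_cond [RHS]big_seq_cond; apply: eq_bigl => w.
  case wp: (w \in _) => //=; rewrite mem_permutations in wp.
  rewrite -val_eqE /= inordK // -[(size s).+1]/(size (m :: s)) -(perm_size wp).
  by rewrite index_mem (perm_mem wp) mem_head.
- by rewrite -ltnS.
by move=> s' s's szs'; apply: IHn => //; apply: leq_ltn_trans szs' szs.
Qed.

End WordSums.

(** * Permutations as words *)

Section PermutationWords.
Local Open Scope nat_scope.

Lemma des_fromE p w :
  des_from p w = \sum_(i < size w) (nth 0 w i < nth 0 (p :: w) i).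
Proof.
by elim: w p => [|x w IHw] p; rewrite ?big_ord0 //= big_ord_recl IHw.
Qed.

Lemma ai_fromE p w : ai_from p w =
  \sum_(i < size w)
    adm_inv (nth 0 (p :: w) i < nth 0 w i) (nth 0 w i) (drop i.+1 w).
Proof.
elim: w p => [|x w IHw] p; rewrite ?big_ord0 //= big_ord_recl IHw /=.
by rewrite drop0.
Qed.

Lemma adm_invE b x v : adm_inv b x v =
  \sum_(k < size v) ((b || has (ltn x) (take k v)) && (nth 0 v k < x)).
Proof.
elim: v b => [|y v IHv] b; rewrite ?big_ord0 //= big_ord_recl IHv /= orbF.
by congr (_ + _); apply: eq_bigr => k _; rewrite orbA.
Qed.

Definition word_of n (s : 'S_n) : seq nat := [seq val (s i) | i <- enum 'I_n].

Lemma size_word_of n (s : 'S_n) : size (word_of s) = n.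
Proof. by rewrite size_map size_enum_ord. Qed.

Lemma nth_word_of n (s : 'S_n) (i : 'I_n) : nth 0 (word_of s) i = s i.
Proof. by rewrite (nth_map i) ?size_enum_ord // nth_ord_enum. Qed.

Lemma perm_word_of n (s : 'S_n) : perm_eq (word_of s) (rev (iota 0 n)).
Proof.
apply: uniq_perm; rewrite ?rev_uniq ?iota_uniq //.
  by rewrite map_inj_uniq ?enum_uniq // => i j /val_inj/perm_inj.
move=> x; rewrite mem_rev mem_iota add0n /=; apply/mapP/idP => [[i _ ->]|xn].
  exact: ltn_ord.
by exists ((s^-1)%g (Ordinal xn)); rewrite ?mem_enum // permKV.
Qed.

Lemma word_of_inj n : injective (@word_of n).
Proof.
move=> s s' E; apply/permP => i; apply: val_inj.
by rewrite /= -!nth_word_of E.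
Qed.

(** There are n! words on each side, so injectivity suffices. *)
Lemma perm_permutations_word_of n :
  perm_eq [seq word_of s | s <- enum {: 'S_n}] (permutations (rev (iota 0 n))).
Proof.
have uw : uniq [seq word_of s | s <- enum {: 'S_n}].
  by rewrite map_inj_uniq ?enum_uniq //; apply: word_of_inj.
apply: uniq_perm; rewrite ?permutations_uniq //.
apply: (uniq_min_size uw _ _).2.
  by move=> _ /mapP[s _ ->]; rewrite mem_permutations perm_word_of.
rewrite size_map -cardE size_permutations ?rev_uniq ?iota_uniq //.
by rewrite size_rev size_iota card_Sn.
Qed.

Lemma des_word_of n (s : 'S_n) : des s = word_des (word_of s).
Proof.
rewrite /word_des des_fromE size_word_of /des cardsE -sum1_card big_mkcond /=.
case: n s => [|m] s; first by rewrite !big_ord0.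
(* The last position is no descent, and neither is the first letter of the word,
   which is compared with itself. *)
rewrite big_ord_recr [RHS]big_ord_recl /= nth0 ltnn.
rewrite [X in _ + X](_ : _ = 0) ?addn0 ?add0n; last first.
  case: ifP => // /existsP[i' /andP[/eqP /= Ei _]].
  by have := ltn_ord i'; rewrite Ei ltnn.
apply: eq_bigr => i _.
have -> : nth 0 (word_of s) (bump 0 i) = s (lift ord0 i) := nth_word_of s (lift ord0 i).
have -> : nth 0 (word_of s) i = s (widen_ord (leqnSn m) i).
  exact: nth_word_of s (widen_ord (leqnSn m) i).
apply: (congr1 nat_of_bool); apply/existsP/idP => [[i' /andP[/eqP Ei]]|lt_s].
  by rewrite (_ : i' = lift ord0 i) //; apply: val_inj.
by exists (lift ord0 i); rewrite /= eqxx.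
Qed.

(** The first clause in the definition of admissibility. At position 0 it fails,
   as does the comparison of the first letter with itself. *)
Lemma asc_word_of n (s : 'S_n) (i : 'I_n) :
  [exists i' : 'I_n, (i == i'.+1 :> nat) && (s i' < s i)] =
  (nth 0 (head 0 (word_of s) :: word_of s) i < nth 0 (word_of s) i).
Proof.
apply/existsP/idP => [[i' /andP[/eqP Ei]]|]; first by rewrite Ei /= -Ei !nth_word_of.
case Ei : (nat_of_ord i) => [|k] /=; first by rewrite nth0 ltnn.
have kn : k < n by rewrite ltnW // -Ei.
rewrite -[k.+1]Ei nth_word_of (nth_word_of s (Ordinal kn)) => lt_s.
by exists (Ordinal kn); rewrite lt_s andbT; apply/eqP.
Qed.

(** The second clause in the definition of admissibility. *)
Lemma between_word_of n (s : 'S_n) (i : 'I_n) k :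
  [exists l : 'I_n, [&& i < l, l < i.+1 + k & s i < s l]] =
  has (ltn (s i)) (take k (drop i.+1 (word_of s))).
Proof.
apply/existsP/(has_nthP 0) => [[l /and3P[il lk lt_s]]|[x]].
  have lk' : l - i.+1 < k by rewrite ltn_subLR.
  have ln : l - i.+1 < n - i.+1 by rewrite ltn_sub2r // (leq_trans _ (ltn_ord l)).
  exists (l - i.+1); first by rewrite size_take_min size_drop size_word_of leq_min lk'.
  by rewrite nth_take // nth_drop subnKC // nth_word_of.
rewrite size_take_min size_drop size_word_of leq_min => /andP[xk xn].
have ln : i.+1 + x < n by rewrite -ltn_subRL.
rewrite nth_take // nth_drop (nth_word_of s (Ordinal ln)) => lt_s.
by exists (Ordinal ln); rewrite /= ltn_add2l xk leq_addr.
Qed.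

Lemma ai_word_of n (s : 'S_n) : ai s = word_ai (word_of s).
Proof.
rewrite /word_ai ai_fromE size_word_of /ai cardsE -sum1_card big_mkcond /=.
rewrite -(pair_bigA _ (fun i j => if is_inversion s i j && is_admissible s i j
                                  then 1 else 0)) /=.
apply: eq_bigr => i _; rewrite adm_invE size_drop size_word_of.
pose G j := if (i < j) && (nth 0 (word_of s) j < s i) &&
   ((nth 0 (head 0 (word_of s) :: word_of s) i < s i) ||
     has (ltn (s i)) (take (j - i.+1) (drop i.+1 (word_of s)))) then 1 else 0.
have -> : \sum_(j < n) (if is_inversion s i j && is_admissible s i j then 1 else 0)
    = \sum_(j < n) G j.
  apply: eq_bigr => j _; rewrite /G /is_inversion /is_admissible asc_word_of.
  rewrite !nth_word_of; case ij: (i < j) => //=.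
  by rewrite -between_word_of subnKC.
rewrite -(big_mkord xpredT G) (@big_cat_nat _ _ _ i.+1) //= big_nat big1 ?add0n; last first.
  by move=> j /andP[_ ji]; rewrite /G ltnNge -ltnS ji.
rewrite -{1}[i.+1]add0n big_addn big_mkord; apply: eq_bigr => k _.
rewrite /G addnC leq_addr addKn nth_drop nth_word_of andbC /=.
by case: (_ && _).
Qed.

Lemma max_at_word_of n (s : 'S_n) (j : nat) : 0 < j <= n ->
  (s \in perms_max_at n j) = (index n.-1 (word_of s) == j.-1).
Proof.
case: j => //= j jn; rewrite inE.
have n_gt0 : 0 < n by apply: leq_trans jn.
have uw : uniq (word_of s) by rewrite (perm_uniq (perm_word_of s)) rev_uniq iota_uniq.
have Ew := nth_word_of s (Ordinal jn).
apply/existsP/eqP => [[i /andP[/eqP[Ei] /eqP sn]]|Ej].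
  have -> : n.-1 = nth 0 (word_of s) j.
    by rewrite -Ei nth_word_of; apply/esym/(congr1 predn sn).
  by rewrite index_uniq // size_word_of.
exists (Ordinal jn); rewrite eqxx /= -Ew /= -Ej nth_index ?prednK //.
by rewrite (perm_mem (perm_word_of s)) mem_rev mem_iota add0n prednK /=.
Qed.

End PermutationWords.

(** * Restricted q-Eulerian polynomials *)

Section RestrictedSum.
Variables (F : fieldType) (q t : F).
Hypothesis qpoch_neq0 : forall n, qpoch q n != 0.
Hypothesis t_neq1 : 1 - t != 0.

Lemma restricted_q_eulerianE n j : (j <= n)%N ->
  restricted_q_eulerian n.+1 j.+1 t q =
  q ^+ j * (qbinom q n j * (q_eulerian t q j * restricted_tail q t (n - j)%N)).
Proof.
move=> jn; rewrite /restricted_q_eulerian /=.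
have -> : restricted_gf j.+1 t q n =
    (fps_monom (q_eulerian t q j * q ^+ j / qpoch q j) j * restricted_fps q t) n by [].
rewrite fps_monomM jn /restricted_tail /qbinom.
by field; rewrite !qpoch_neq0.
Qed.

(** For j > 0 the maximum n of a word on 0, ..., n is not its first letter, and
   each of the n - j letters after it accounts for one factor q. *)
Lemma sum_weight_perms_max_at n j : (0 < j <= n)%N ->
  \sum_(s in perms_max_at n.+1 j.+1) weight q t (word_of s) =
  q ^+ (n - j) * (qbinom q n j * (q_eulerian t q j * restricted_tail q t (n - j)%N)).
Proof.
move=> /andP[j_gt0 jn].
have Ei : rev (iota 0 n.+1) = n :: rev (iota 0 n).
  by rewrite -addn1 iotaD rev_cat.
have srt m : sorted gtn (rev (iota 0 m)) by rewrite rev_sorted iota_ltn_sorted.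
have szn : size (rev (iota 0 n)) = n by rewrite size_rev size_iota.
transitivity (\sum_(w <- permutations (n :: rev (iota 0 n)) | index n w == j) weight q t w).
  rewrite -Ei -(perm_big _ (perm_permutations_word_of n.+1)) big_map big_enum_cond.
  by apply: eq_bigl => s; rewrite max_at_word_of.
rewrite (sum_weight_max_at qpoch_neq0 t_neq1) -?Ei ?szn ?gtn_eqF //.
  by rewrite [LHS]mulrAC [LHS]mulrC.
by move=> s ss _; apply: sum_weight_permutations.
Qed.

End RestrictedSum.

Lemma qpoch_qvar_neq0 n : qpoch (cst qvar) n != 0.
Proof.
rewrite qpoch_cst fmorph_eq0 /qpoch prodf_seq_neq0; apply/allP => i.
rewrite mem_index_iota => /andP[i_gt0 _] /=; rewrite /qvar -tofracXn.
rewrite -(rmorph1 (@tofrac {poly rat})) -tofracB tofrac_eq0 subr_eq0.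
apply/eqP => /(congr1 (fun p : {poly rat} => p`_0)) /eqP.
by rewrite coef1 coefXn (ltn_eqF i_gt0) oner_eq0.
Qed.

Lemma qvar_neq0 : qvar != 0.
Proof. by rewrite /qvar tofrac_eq0 polyX_eq0. Qed.

Lemma restricted_q_eulerian_tpoly_sum n j : (0 < j <= n)%N ->
  restricted_q_eulerian_tpoly n.+1 j.+1 =
  \sum_(s in perms_max_at n.+1 j.+1)
    qvar ^ ((ai s)%:Z + 2 * j.+1%:Z - n.+1%:Z - 1) *: 'X^(des s).
Proof.
move=> jn; apply/eqP; rewrite -tofrac_eq restricted_q_eulerian_tpolyE; apply/eqP.
have le_jn : (j <= n)%N by case/andP: jn.
rewrite (restricted_q_eulerianE _ qpoch_qvar_neq0) // rmorph_sum /=.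
have q0 : cst qvar != 0 by rewrite fmorph_eq0 qvar_neq0.
(* The factor q^(n - j) is the one on the right of [sum_weight_perms_max_at]. *)
apply: (@mulfI _ (cst qvar ^+ (n - j))); first by rewrite expf_neq0.
rewrite mulrCA -(sum_weight_perms_max_at qpoch_qvar_neq0 tvar_neq1 jn) !mulr_sumr.
apply: eq_bigr => s _.
rewrite /weight -des_word_of -ai_word_of -mul_polyC tofracM tofracXn.
rewrite -/(cst _) -/tvar mulrCA [RHS]mulrA [RHS]mulrC; congr (_ * _).
rewrite fmorphXz !exprnP -!expfzDr //; congr (_ ^ _).
by rewrite -subzn // !intS; ring.
Qed.

Theorem lemma10 (n j k : nat) (j_ge2 : (2 <= j)%N) (j_le_n : (j <= n)%N) :
  restricted_q_eulerian_number n j k =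
  \sum_(s in perms_max_at n j | des s == k)
    qvar ^ ((ai s)%:Z + 2 * j%:Z - n%:Z - 1).
Proof.
case: n j j_ge2 j_le_n => [|n] [|j] //; rewrite !ltnS => j_gt0 jn.
rewrite /restricted_q_eulerian_number restricted_q_eulerian_tpoly_sum ?j_gt0 //.
rewrite coef_sum big_mkcondr; apply: eq_bigr => s _.
by rewrite coefZ coefXn eq_sym; case: eqP; rewrite ?mulr1 ?mulr0.
Qed.
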